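(* Let $A=\Pi_Q(k)$ with $Q=\widetilde{A_{n-1}}$, and let $g$ be a graded automorphism of $A$ (of not necessarily finite order) with $g(e_i)=e_i$ for all $i=1,\dots,n$; write $g(\alpha_i)=c_i\alpha_i$ and $g(\alpha_i^\ast)=t_i\alpha_i^\ast$ with $c_i,t_i\in k$, indices of $c_i,t_i$ being read modulo $n$, and let $g_i=g|_{e_iA}$. An empty product equals $1$. Then: (a) The vector $(1-t_1\cdots t_nt^n)\cdot\underline{\operatorname{Tr}}_A(g,t)$ equals $M^{-1}v$, where $M$ is the $n\times n$ matrix with $M_{ii}=1$ for all $i$, $M_{i,i+1}=-c_it$ for $1\le i\le n-1$, $M_{n,1}=-c_nt$, and all other entries $0$, and $v$ is the column vector whose $\ell$-th entry is $$\sum_{k=0}^{n-1}\left(\prod_{j=n-k+\ell}^{n+\ell-1}t_j\right)t^k,\qquad \ell=1,\dots,n.$$ (b) The trace $\operatorname{Tr}_A(g,t)$ can be written as a fraction $\frac{p(t)}{q(t)}$ of the two polynomials $$p(t)=\sum_{v=0}^{2n-2}\left(\sum_{\substack{v=k+s\\0\le k,s\le n-1}}\ \sum_{\ell=1}^{n}\ \prod_{j=n-k+\ell}^{n+\ell-1}t_j\prod_{r=n-s+\ell}^{n+\ell-1}c_r\right)t^v,\qquad q(t)=(1-c_1\cdots c_nt^n)(1-t_1\cdots t_nt^n)$$ (which may fail to be coprime). (c) Similarly, for each $i$, $\operatorname{Tr}_{e_iA}(g_i,t)=\frac{p_i(t)}{q_i(t)}$ for some polynomial $p_i(t)$, with $q_i(t)=(1-c_1\cdots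 c_nt^n)(1-t_1\cdots t_nt^n)$. (d) If $g$ has finite order, all roots of $q(t)$ (respectively $q_i(t)$) are roots of unity. Additionally, the order of $1$ as a pole of $\operatorname{Tr}_A(g,t)$ (respectively $\operatorname{Tr}_{e_iA}(g_i,t)$) can be at most two.
   Context: $k$ is an algebraically closed field of characteristic $0$. Let $n\ge 3$ and let $Q=\widetilde{A_{n-1}}$ be the quiver with vertices $e_1,\dots,e_n$ and one arrow $\alpha_i$ from $e_i$ to $e_{i+1}$ for each $i=1,\dots,n$ (indices modulo $n$). Its double $\bar Q$ has the same vertices, the arrows $\alpha_i$, and additional arrows $\alpha_i^\ast$ from $e_{i+1}$ to $e_i$. Paths are composed left to right, and $e_i$ also denotes the trivial path at the vertex $e_i$. The preprojective algebra is $A=\Pi_Q(k)=k\bar Q/\left(\sum_i\alpha_i\alpha_i^\ast-\sum_i\alpha_i^\ast\alpha_i\right)$, i.e. $k\bar Q$ modulo the relations $\alpha_i\alpha_i^\ast=\alpha_{i-1}^\ast\alpha_{i-1}$, graded by path length. A graded automorphism is an algebra automorphism $g$ with $g(A_j)=A_j$ for all $j$. If $g(e_i)=e_i$ for all $i$ then necessarily $g(\alpha_i)=c_i\alpha_i$, $g(\alpha_i^\ast)=t_i\alpha_i^\ast$ for nonzero scalars with $c_it_i=c_1t_1$ for all $i$. Traces are formal power series in $t$: $\operatorname{Tr}_A(g,t)=\sum_{s\ge0}\operatorname{tr}(g|_{A_s})t^s$ and $\operatorname{Tr}_{e_iA}(g_i,t)=\sum_{s\ge0}\operatorname{tr}(g|_{e_iA_s})t^s$.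 The vector trace $\underline{\operatorname{Tr}}_A(g,t)$ is the column vector with $j$-th entry $\operatorname{Tr}_{e_jA}(g_j,t)$, $j=1,\dots,n$. (In sums, the summation index $k$ is an integer, not the field.) *)

(* Defs.v *)
From HB Require Import structures.
From mathcomp Require Import all_boot all_order all_algebra.
From mathcomp Require Import boolp classical_sets.
From mathcomp.finmap Require Import finmap.
From mathcomp.multinomials Require Import monalg.

Set Implicit Arguments.
Unset Strict Implicit.
Unset Printing Implicit Defensive.

Import GRing.Theory.

Local Open Scope ring_scope.
Local Open Scope quotient_scope.

Record fps (k : fieldType) := Fps { fps_coef : nat -> k }.

Section FpsRing.
Variable k : fieldType.
Implicit Types f g h : fps k.

Local Notation "f `_[ n ]" := (fps_coef f n) (at level 2, format "f `_[ n ]").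

HB.instance Definition _ := gen_eqMixin (fps k).
HB.instance Definition _ := gen_choiceMixin (fps k).

Lemma fpsP f g : (forall n, f`_[n] = g`_[n]) -> f = g.
Proof. by case: f g => [f] [g] /= /funext ->. Qed.

Definition fps_zero : fps k := Fps (fun=> 0).
Definition fps_opp f : fps k := Fps (fun n => - f`_[n]).
Definition fps_add f g : fps k := Fps (fun n => f`_[n] + g`_[n]).

Fact fps_addA : associative fps_add.
Proof. by move=> f g h; apply: fpsP => n /=; rewrite addrA. Qed.
Fact fps_addC : commutative fps_add.
Proof. by move=> f g; apply: fpsP => n /=; rewrite addrC. Qed.
Fact fps_add0 : left_id fps_zero fps_add.
Proof. by move=> f; apply: fpsP => n /=; rewrite add0r. Qed.
Fact fps_addN : left_inverse fps_zero fps_opp fps_add.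
Proof. by move=> f; apply: fpsP => n /=; rewrite addNr. Qed.

HB.instance Definition _ :=
  GRing.isZmodule.Build (fps k) fps_addA fps_addC fps_add0 fps_addN.

Definition fps_of_poly (p : {poly k}) : fps k := Fps (fun n => p`_n).

Definition fps_mul f g : fps k :=
  Fps (fun n => \sum_(i < n.+1) f`_[i] * g`_[n - i]).

(* Coefficients up to degree [n] of a product only depend on the truncations, *)
(* so the ring laws are inherited from polynomials.                           *)
Definition fps_trunc n f : {poly k} := \poly_(i < n.+1) f`_[i].

Fact fps_truncE n f i : (i <= n)%N -> (fps_trunc n f)`_i = f`_[i].
Proof. by move=> le_in; rewrite coef_poly ltnS le_in. Qed.

Fact coefM_congr n (p p' q q' : {poly k}) :
  (forall i, (i <= n)%N -> p`_i = p'`_i) ->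
  (forall i, (i <= n)%N -> q`_i = q'`_i) -> (p * q)`_n = (p' * q')`_n.
Proof.
move=> eqp eqq; rewrite !coefM; apply: eq_bigr => i _.
by rewrite eqp ?eqq ?leq_subr // -ltnS.
Qed.

Fact fps_mulE n f g i :
  (i <= n)%N -> (fps_mul f g)`_[i] = (fps_trunc n f * fps_trunc n g)`_i.
Proof.
move=> le_in; rewrite coefM; apply: eq_bigr => j _.
rewrite !fps_truncE ?(leq_trans (leq_subr _ _)) //.
by apply: leq_trans le_in; rewrite -ltnS.
Qed.

Fact fps_mulA : associative fps_mul.
Proof.
move=> f g h; apply: fpsP => n; rewrite !(fps_mulE _ _ (leqnn n)).
rewrite (@coefM_congr n _ (fps_trunc n f) _ (fps_trunc n g * fps_trunc n h)) //.
  rewrite mulrA; apply: coefM_congr => // i le_in.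
  by rewrite fps_truncE // (fps_mulE _ _ le_in).
by move=> i le_in; rewrite fps_truncE // (fps_mulE _ _ le_in).
Qed.

Fact fps_mulC : commutative fps_mul.
Proof.
by move=> f g; apply: fpsP => n; rewrite !(fps_mulE _ _ (leqnn n)) mulrC.
Qed.

Fact fps_mul1 : left_id (fps_of_poly 1) fps_mul.
Proof.
move=> f; apply: fpsP => n; rewrite (fps_mulE _ _ (leqnn n)).
rewrite (@coefM_congr n _ 1 _ (fps_trunc n f)) ?mul1r ?fps_truncE //.
by move=> i le_in; rewrite fps_truncE.
Qed.

Fact fps_mulDl : left_distributive fps_mul +%R.
Proof.
move=> f g h; apply: fpsP => n /=; rewrite -big_split /=.
by apply: eq_bigr => i _; rewrite mulrDl.
Qed.

Fact fps_oner_neq0 : fps_of_poly 1 != 0.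
Proof.
apply/eqP => /(congr1 (fun f => f`_[0])) /= /eqP.
by rewrite coef1 oner_eq0.
Qed.

HB.instance Definition _ := GRing.Zmodule_isComNzRing.Build (fps k)
  fps_mulA fps_mulC fps_mul1 fps_mulDl fps_oner_neq0.

Definition fps_unit : {pred fps k} := [pred f | `[< exists g, g * f = 1 >]].
Definition fps_inv f : fps k := xget f [set g | g * f = 1].

Fact fps_mulV : {in fps_unit, left_inverse 1 fps_inv *%R}.
Proof.
by move=> f /asboolP exg; exact: (xgetPex f exg).
Qed.
Fact fps_unitPl f g : g * f = 1 -> fps_unit f.
Proof. by move=> gf1; apply/asboolP; exists g. Qed.
Fact fps_inv_out : {in [predC fps_unit], fps_inv =1 id}.
Proof.
by move=> f /asboolPn nf; apply: xgetPN => g gf1; apply: nf; exists g.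
Qed.

HB.instance Definition _ := GRing.ComNzRing_hasMulInverse.Build (fps k)
  fps_mulV fps_unitPl fps_inv_out.

End FpsRing.

(* The power series [f] is the expansion of a rational function having a pole *)
(* of order [m] at [a] (no pole when [m = 0]): [m] is the multiplicity of [a] *)
(* as a root of the denominator of the reduced fraction [p / q].              *)
Definition pole_order (k : fieldType) (f : fps k) (a : k) (m : nat) : Prop :=
  exists p q : {poly k},
    [/\ q != 0, coprimep p q, fps_of_poly q * f = fps_of_poly p & m = mup a q].

Section TraceOn.
Variables (k : fieldType) (V : lmodType k).

Definition lin_comb d (b : 'I_d -> V) (a : 'rV[k]_d) : V :=
  \sum_(i < d) a 0 i *: b i.

Definition is_basis_of (U : set V) d (b : 'I_d -> V) : Prop :=
  injective (lin_comb b) /\ range (lin_comb b) = U.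

(* Meaningful when [U] is a finite-dimensional subspace and [f] is linear     *)
(* with [f @` U `<=` U]; the default value 0 is then never used.              *)
Definition trace_on (f : V -> V) (U : set V) : k :=
  xget 0 [set c | exists d (b : 'I_d -> V) (M : 'M[k]_d),
    [/\ is_basis_of U b,
        forall i, f (b i) = lin_comb b (row i M)
      & c = \tr M]].

End TraceOn.

Record quiver := Quiver {
  vertex : finType;
  arrow : finType;
  qsrc : arrow -> vertex;
  qtgt : arrow -> vertex }.

(* [inl a] is the arrow [a] and [inr a] is the opposite arrow [a^*].          *)
Definition double_quiver (Q : quiver) : quiver :=
  @Quiver (vertex Q) (arrow Q + arrow Q)%type
    (fun x => match x with inl a => qsrc a | inr a => qtgt a end)
    (fun x => match x with inl a => qtgt a | inr a => qsrc a end).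

Section Paths.
Variable Q : quiver.

Fixpoint walk (v : vertex Q) (s : seq (arrow Q)) : bool :=
  if s is a :: s' then (qsrc a == v) && walk (qtgt a) s' else true.

(* A path is a starting vertex with a list of consecutive arrows, read from   *)
(* left to right; the empty list gives the trivial path.                      *)
Definition qpath := {p : vertex Q * seq (arrow Q) | walk p.1 p.2}.

Definition pstart (p : qpath) : vertex Q := (val p).1.
Definition parrows (p : qpath) : seq (arrow Q) := (val p).2.
Definition pend (p : qpath) : vertex Q :=
  last (pstart p) [seq qtgt a | a <- parrows p].
Definition plen (p : qpath) : nat := size (parrows p).

Definition trivial_path (v : vertex Q) : qpath := exist _ (v, [::]) isT.

Fact arrow_walk (a : arrow Q) : walk (qsrc a) [:: a].
Proof. by rewrite /= eqxx. Qed.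
Definition arrow_path (a : arrow Q) : qpath :=
  exist _ (qsrc a, [:: a]) (arrow_walk a).

Lemma walk_cat v s1 s2 :
  walk v (s1 ++ s2) = walk v s1 && walk (last v [seq qtgt a | a <- s1]) s2.
Proof. by elim: s1 v => [|a s IHs] v //=; rewrite IHs andbA. Qed.

Fact pcat_walk (p q : qpath) :
  pend p = pstart q -> walk (pstart p) (parrows p ++ parrows q).
Proof.
move=> eq_pq; rewrite walk_cat (valP p) /=.
by rewrite -/(pend p) eq_pq (valP q).
Qed.

(* [None] when the paths are not composable; by [pcat_walk] the test made by  *)
(* [insub] always succeeds on composable paths.                               *)
Definition pcat (p q : qpath) : option qpath :=
  if pend p == pstart q
  then (insub (pstart p, parrows p ++ parrows q) : option qpath) else None.

Lemma pcatP (p q : qpath) (e : pend p = pstart q) :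
  pcat p q = Some (exist _ (pstart p, parrows p ++ parrows q) (pcat_walk e)).
Proof.
rewrite /pcat e eqxx; case: insubP => [r _ vr|/negP[]]; last exact: pcat_walk.
by congr Some; apply: val_inj.
Qed.

Lemma pcat_some (p q r : qpath) : pcat p q = Some r ->
  [/\ pend p = pstart q, pstart r = pstart p, pend r = pend q
    & parrows r = parrows p ++ parrows q].
Proof.
case: (pend p =P pstart q) => [e|/eqP/negPf ne]; last by rewrite /pcat ne.
rewrite (pcatP e) => -[<-]; split => //.
by rewrite /pend /= map_cat last_cat -/(pend p) e.
Qed.

Lemma pcat_none (p q : qpath) : pend p <> pstart q -> pcat p q = None.
Proof. by move/eqP/negPf; rewrite /pcat => ->. Qed.

Lemma qpathP (p q : qpath) :
  pstart p = pstart q -> parrows p = parrows q -> p = q.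
Proof.
case: p q => [[v s] vs] [[w t] wt]; rewrite /pstart /parrows /= => e1 e2.
by apply: val_inj; rewrite /= e1 e2.
Qed.

Lemma pcatA (p q r : qpath) :
  obind (pcat p) (pcat q r) = obind (fun x => pcat x r) (pcat p q).
Proof.
case E1: (pcat q r) => [x|]; case E2: (pcat p q) => [y|] //=.
- have [e1 s1 n1 a1] := pcat_some E1; have [e2 s2 n2 a2] := pcat_some E2.
  have e3 : pend p = pstart x by rewrite s1.
  have e4 : pend y = pstart r by rewrite n2.
  rewrite (pcatP e3) (pcatP e4); congr Some; apply: qpathP => /=.
    by rewrite /pstart /= -/(pstart p) -/(pstart y) s2.
  by rewrite /parrows /= -/(parrows x) -/(parrows y) a1 a2 catA.
- have [e1 s1 _ _] := pcat_some E1; rewrite pcat_none // s1 => e.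
  by rewrite (pcatP e) in E2.
- have [_ _ n2 _] := pcat_some E2; rewrite pcat_none // n2 => e.
  by rewrite (pcatP e) in E1.
Qed.

End Paths.

Definition path_alg (k : fieldType) (Q : quiver) : Type := {malg k[qpath Q]}.
HB.instance Definition _ (k : fieldType) (Q : quiver) :=
  GRing.Lmodule.on (path_alg k Q).

HB.lock Definition pbasis (k : fieldType) (Q : quiver) (p : qpath Q) :
  path_alg k Q := << p >>.
Canonical pbasis_unlockable := Unlockable pbasis.unlock.
Arguments pbasis k {Q} p.

(* The product of two paths is their concatenation, or 0.                     *)
HB.lock Definition pa_mul (k : fieldType) (Q : quiver) (f g : path_alg k Q) :
    path_alg k Q :=
  \sum_(p <- msupp f) \sum_(q <- msupp g)
     (f@_p * g@_q) *: oapp (@pbasis k Q) 0 (pcat p q).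
Canonical pa_mul_unlockable := Unlockable pa_mul.unlock.
Arguments pa_mul {k Q} f g.

Section PathAlgebra.
Variables (k : fieldType) (Q : quiver).

Local Notation path_alg := (path_alg k Q).
Local Notation pbasis := (@pbasis k Q).
Local Notation B := (oapp pbasis 0).

Implicit Types (f g h : path_alg) (p q r : qpath Q).

Definition pa_one : path_alg := \sum_(v : vertex Q) pbasis (trivial_path v).

Lemma mcoeff_pbasis p q : (pbasis p)@_q = (p == q)%:R.
Proof. by rewrite unlock mcoeffU. Qed.

Lemma msupp_pbasis p : (msupp (pbasis p) `<=` [fset p])%fset.
Proof. by rewrite unlock; exact: msuppU_le. Qed.

Lemma pbasisE f : f = \sum_(p <- msupp f) f@_p *: pbasis p.
Proof.
rewrite [LHS]monalgE; apply: eq_bigr => p _; apply/malgP => q.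
by rewrite mcoeffU mcoeffZ mcoeff_pbasis mulr_natr.
Qed.

Fact pa_mulw (d1 d2 : {fset qpath Q}) f g :
  (msupp f `<=` d1)%fset -> (msupp g `<=` d2)%fset ->
  pa_mul f g = \sum_(p <- d1) \sum_(q <- d2) (f@_p * g@_q) *: B (pcat p q).
Proof.
move=> le1 le2; rewrite unlock (big_fset_incl _ le1) /=.
  apply/eq_bigr => p _; apply/big_fset_incl => // q _ /mcoeff_outdom ->.
  by rewrite mulr0 scale0r.
by move=> p _ /mcoeff_outdom fp; rewrite big1 // => q _; rewrite fp mul0r scale0r.
Qed.

Fact pa_mulDl : left_distributive (@pa_mul k Q) +%R.
Proof.
move=> f g h.
rewrite (pa_mulw (msuppD_le _ _) (fsubset_refl _)).
rewrite (pa_mulw (fsubsetUl (msupp f) (msupp g)) (fsubset_refl (msupp h))).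
rewrite (pa_mulw (fsubsetUr (msupp f) (msupp g)) (fsubset_refl (msupp h))).
rewrite -big_split /=; apply/eq_bigr => p _; rewrite -big_split /=.
by apply/eq_bigr => q _; rewrite mcoeffD mulrDl scalerDl.
Qed.

Fact pa_mulDr : right_distributive (@pa_mul k Q) +%R.
Proof.
move=> h f g.
rewrite (pa_mulw (fsubset_refl _) (msuppD_le _ _)).
rewrite (pa_mulw (fsubset_refl (msupp h)) (fsubsetUl (msupp f) (msupp g))).
rewrite (pa_mulw (fsubset_refl (msupp h)) (fsubsetUr (msupp f) (msupp g))).
rewrite -big_split /=; apply/eq_bigr => p _; rewrite -big_split /=.
by apply/eq_bigr => q _; rewrite mcoeffD mulrDr scalerDl.
Qed.

Lemma pa_scaleAl c f g : c *: pa_mul f g = pa_mul (c *: f) g.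
Proof.
rewrite (pa_mulw (msuppZ_le _ _) (fsubset_refl (msupp g)))
  [in LHS]unlock scaler_sumr.
apply: eq_bigr => p _; rewrite scaler_sumr; apply: eq_bigr => q _.
by rewrite mcoeffZ scalerA mulrA.
Qed.

Lemma pa_scaleAr c f g : c *: pa_mul f g = pa_mul f (c *: g).
Proof.
rewrite (pa_mulw (fsubset_refl (msupp f)) (msuppZ_le _ _))
  [in LHS]unlock scaler_sumr.
apply: eq_bigr => p _; rewrite scaler_sumr; apply: eq_bigr => q _.
by rewrite mcoeffZ scalerA mulrCA.
Qed.

Fact pa_mul0g g : pa_mul 0 g = 0.
Proof. by rewrite unlock msupp0 big_seq_fset0. Qed.

Fact pa_mulg0 g : pa_mul g 0 = 0.
Proof. by have := pa_scaleAr 0 g 0; rewrite !scale0r => <-. Qed.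

Fact pa_mulPl c f g h : pa_mul (c *: f + g) h = c *: pa_mul f h + pa_mul g h.
Proof. by rewrite pa_mulDl -pa_scaleAl. Qed.

Fact pa_mulPr c f g h : pa_mul h (c *: f + g) = c *: pa_mul h f + pa_mul h g.
Proof. by rewrite pa_mulDr -pa_scaleAr. Qed.

Lemma pa_ext (F G : path_alg -> path_alg) : linear F -> linear G ->
  (forall p, F (pbasis p) = G (pbasis p)) -> F =1 G.
Proof.
move=> linF linG eqFG f.
have F0 : F 0 = 0 by have := linF (-1) 0 0; rewrite scaler0 addr0 scaleN1r addNr.
have G0 : G 0 = 0 by have := linG (-1) 0 0; rewrite scaler0 addr0 scaleN1r addNr.
rewrite (pbasisE f); elim: (enum_fset _) => [|p s IHs].
  by rewrite big_nil F0 G0.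
by rewrite big_cons linF linG eqFG IHs.
Qed.

Lemma pa_mulUU p q : pa_mul (pbasis p) (pbasis q) = B (pcat p q).
Proof.
rewrite (pa_mulw (msupp_pbasis p) (msupp_pbasis q)) !big_seq_fset1.
by rewrite !mcoeff_pbasis !eqxx mul1r scale1r.
Qed.

Fact pa_mulBr p (o : option (qpath Q)) :
  pa_mul (pbasis p) (B o) = B (obind (pcat p) o).
Proof. by case: o => [q|] /=; rewrite ?pa_mulg0 ?pa_mulUU. Qed.

Fact pa_mulBl p (o : option (qpath Q)) :
  pa_mul (B o) (pbasis p) = B (obind (fun q => pcat q p) o).
Proof. by case: o => [q|] /=; rewrite ?pa_mul0g ?pa_mulUU. Qed.

Fact pa_mulA : associative (@pa_mul k Q).
Proof.
move=> f g h.
apply: (pa_ext (F := fun f => pa_mul f (pa_mul g h))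
               (G := fun f => pa_mul (pa_mul f g) h)) => [a x y|a x y|p].
- by rewrite pa_mulPl.
- by rewrite !pa_mulPl.
apply: (pa_ext (F := fun g => pa_mul (pbasis p) (pa_mul g h))
               (G := fun g => pa_mul (pa_mul (pbasis p) g) h)) => [a x y|a x y|q].
- by rewrite pa_mulPl pa_mulPr.
- by rewrite pa_mulPr pa_mulPl.
apply: (pa_ext (F := fun h => pa_mul (pbasis p) (pa_mul (pbasis q) h))
               (G := fun h => pa_mul (pa_mul (pbasis p) (pbasis q)) h))
  => [a x y|a x y|r].
- by rewrite !pa_mulPr.
- by rewrite pa_mulPr.
by rewrite !pa_mulUU pa_mulBr pa_mulBl pcatA.
Qed.

Fact pa_mul1g : left_id pa_one (@pa_mul k Q).
Proof.
apply: (pa_ext (G := id)) => [a x y|//|p]; first exact: pa_mulPr.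
rewrite /pa_one (big_morph (fun x => pa_mul x (pbasis p))
  (fun _ _ => pa_mulDl _ _ _) (pa_mul0g _)) (bigD1 (pstart p)) //=.
rewrite pa_mulUU big1 ?addr0 => [|v nev]; last first.
  by rewrite pa_mulUU pcat_none // => e; case/eqP: nev.
have e : pend (trivial_path (pstart p)) = pstart p by [].
by rewrite (pcatP e) /=; congr pbasis; apply: qpathP.
Qed.

Fact pa_mulg1 : right_id pa_one (@pa_mul k Q).
Proof.
apply: (pa_ext (G := id)) => [a x y|//|p]; first exact: pa_mulPl.
rewrite /pa_one (big_morph (fun x => pa_mul (pbasis p) x)
  (fun _ _ => pa_mulDr _ _ _) (pa_mulg0 _)) (bigD1 (pend p)) //=.
rewrite pa_mulUU big1 ?addr0 => [|v nev]; last first.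
  by rewrite pa_mulUU pcat_none // => e; case/eqP: nev.
have e : pend p = pstart (trivial_path (pend p)) by [].
by rewrite (pcatP e) /=; congr pbasis; apply: qpathP; rewrite ?/parrows /= ?cats0.
Qed.

HB.instance Definition _ := GRing.Zmodule_isPzRing.Build path_alg
  pa_mulA pa_mul1g pa_mulg1 pa_mulDl pa_mulDr.

End PathAlgebra.

Section PathAlgebraQuotient.
Variables (k : fieldType) (Q : quiver) (rho : path_alg k Q).
Local Notation P := (path_alg k Q).

Definition principal_ideal : {pred P} :=
  [pred x | `[< exists s : seq (P * P), x = \sum_(u <- s) u.1 * rho * u.2 >]].

Fact principal_ideal_zmod : zmod_closed principal_ideal.
Proof.
split=> [|x y /asboolP[s ->] /asboolP[t ->]]; apply/asboolP.
  by exists [::]; rewrite big_nil.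
exists (s ++ [seq (- u.1, u.2) | u <- t]); rewrite big_cat big_map /= -sumrN.
by congr (_ + _); apply: eq_bigr => u _; rewrite !mulNr.
Qed.
HB.instance Definition _ :=
  GRing.isZmodClosed.Build P principal_ideal principal_ideal_zmod.

Lemma principal_idealMl x y : y \in principal_ideal -> x * y \in principal_ideal.
Proof.
move=> /asboolP[s ->]; apply/asboolP; exists [seq (x * u.1, u.2) | u <- s].
by rewrite big_map mulr_sumr; apply: eq_bigr => u _; rewrite !mulrA.
Qed.

Lemma principal_idealMr x y : x \in principal_ideal -> x * y \in principal_ideal.
Proof.
move=> /asboolP[s ->]; apply/asboolP; exists [seq (u.1, u.2 * y) | u <- s].
by rewrite big_map mulr_suml; apply: eq_bigr => u _; rewrite !mulrA.
Qed.

Lemma principal_idealZ c x : x \in principal_ideal -> c *: x \in principal_ideal.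
Proof.
by rewrite -(mul1r x) [_ *: _]pa_scaleAl => Ix; apply: principal_idealMl;
  rewrite mul1r in Ix.
Qed.

Definition pa_quot : Type := Quotient.quot principal_ideal.
HB.instance Definition _ := GRing.Zmodule.on pa_quot.
HB.instance Definition _ := Quotient.on pa_quot.

Definition pa_pi (x : P) : pa_quot := \pi_(Quotient.quot principal_ideal) x.

Lemma pa_pi_eq x y : pa_pi x = pa_pi y <-> x - y \in principal_ideal.
Proof.
rewrite Quotient.idealrBE; split=> [e|/eqP //]; first by apply/eqP.
Qed.

Lemma pa_piD x y : pa_pi (x + y) = pa_pi x + pa_pi y.
Proof. exact: (raddfD (\pi_(Quotient.quot principal_ideal))). Qed.

Lemma pa_piK (x : pa_quot) : pa_pi (repr x) = x.
Proof. exact: reprK. Qed.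

Definition paq_one : pa_quot := pa_pi 1.
Definition paq_mul (x y : pa_quot) : pa_quot := pa_pi (repr x * repr y).
Definition paq_scale (c : k) (x : pa_quot) : pa_quot := pa_pi (c *: repr x).

Fact paq_mulE x y : paq_mul (pa_pi x) (pa_pi y) = pa_pi (x * y).
Proof.
apply/pa_pi_eq.
have ex : repr (pa_pi x) - x \in principal_ideal by apply/pa_pi_eq; exact: pa_piK.
have ey : repr (pa_pi y) - y \in principal_ideal by apply/pa_pi_eq; exact: pa_piK.
rewrite -(subrKA (x * repr (pa_pi y))) -mulrBl -mulrBr.
rewrite rpredD //; first exact: principal_idealMr.
exact: principal_idealMl.
Qed.

Fact paq_scaleE c x : paq_scale c (pa_pi x) = pa_pi (c *: x).
Proof.
apply/pa_pi_eq; rewrite -scalerBr; apply: principal_idealZ.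
by apply/pa_pi_eq; exact: pa_piK.
Qed.

Fact paq_mulA : associative paq_mul.
Proof.
move=> x y z; rewrite -(pa_piK x) -(pa_piK y) -(pa_piK z).
by rewrite !paq_mulE mulrA.
Qed.
Fact paq_mul1g : left_id paq_one paq_mul.
Proof. by move=> x; rewrite -(pa_piK x) paq_mulE mul1r. Qed.
Fact paq_mulg1 : right_id paq_one paq_mul.
Proof. by move=> x; rewrite -(pa_piK x) paq_mulE mulr1. Qed.
Fact paq_mulDl : left_distributive paq_mul +%R.
Proof.
move=> x y z; rewrite -(pa_piK x) -(pa_piK y) -(pa_piK z).
by rewrite -pa_piD !paq_mulE mulrDl pa_piD.
Qed.
Fact paq_mulDr : right_distributive paq_mul +%R.
Proof.
move=> x y z; rewrite -(pa_piK x) -(pa_piK y) -(pa_piK z).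
by rewrite -pa_piD !paq_mulE mulrDr pa_piD.
Qed.
HB.instance Definition _ := GRing.Zmodule_isPzRing.Build pa_quot
  paq_mulA paq_mul1g paq_mulg1 paq_mulDl paq_mulDr.

Fact paq_scaleA a b x : paq_scale a (paq_scale b x) = paq_scale (a * b) x.
Proof. by rewrite -(pa_piK x) !paq_scaleE scalerA. Qed.
Fact paq_scale1 : left_id 1 paq_scale.
Proof. by move=> x; rewrite -(pa_piK x) !paq_scaleE scale1r. Qed.
Fact paq_scaleDr : right_distributive paq_scale +%R.
Proof.
move=> a x y; rewrite -(pa_piK x) -(pa_piK y) -pa_piD !paq_scaleE.
by rewrite scalerDr pa_piD.
Qed.
Fact paq_scaleDl x : {morph paq_scale^~ x : a b / a + b}.
Proof.
by move=> a b; rewrite -(pa_piK x) !paq_scaleE scalerDl pa_piD.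
Qed.
HB.instance Definition _ := GRing.Zmodule_isLmodule.Build k pa_quot
  paq_scaleA paq_scale1 paq_scaleDr paq_scaleDl.

Lemma pa_piM x y : pa_pi (x * y) = pa_pi x * pa_pi y.
Proof. by rewrite -paq_mulE. Qed.

Lemma pa_piZ c x : pa_pi (c *: x) = c *: pa_pi x.
Proof. by rewrite -paq_scaleE. Qed.

Lemma pa_pi_is_monoid_morphism : monoid_morphism pa_pi.
Proof. by split=> // x y; exact: pa_piM. Qed.

Lemma pa_pi_is_linear : linear pa_pi.
Proof. by move=> a x y; rewrite pa_piD pa_piZ. Qed.

Lemma paq_scaleAl (c : k) (x y : pa_quot) : c *: (x * y) = (c *: x) * y.
Proof.
rewrite -(pa_piK x) -(pa_piK y); move: (repr x) (repr y) => u v.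
by rewrite -(pa_piM u v) -(pa_piZ c u) -pa_piM -pa_piZ; congr pa_pi; exact: pa_scaleAl.
Qed.

Lemma paq_scaleAr (c : k) (x y : pa_quot) : c *: (x * y) = x * (c *: y).
Proof.
rewrite -(pa_piK x) -(pa_piK y); move: (repr x) (repr y) => u v.
by rewrite -(pa_piM u v) -(pa_piZ c v) -pa_piM -pa_piZ; congr pa_pi; exact: pa_scaleAr.
Qed.

(* Image of the span of the paths of length [s].                              *)
Definition graded_part (s : nat) : set pa_quot :=
  [set pa_pi f | f in [set f : P | forall p, p \in msupp f -> plen p = s]].

End PathAlgebraQuotient.

Section Preprojective.
Variables (k : fieldType) (Q : quiver).

Definition preproj_rel : path_alg k (double_quiver Q) :=
  \sum_(a : arrow Q) pbasis k (arrow_path (inl a : arrow (double_quiver Q)))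
                   * pbasis k (arrow_path (inr a : arrow (double_quiver Q)))
  - \sum_(a : arrow Q) pbasis k (arrow_path (inr a : arrow (double_quiver Q)))
                     * pbasis k (arrow_path (inl a : arrow (double_quiver Q))).

Definition preproj : Type := pa_quot preproj_rel.
HB.instance Definition _ := GRing.Lmodule.on preproj.
HB.instance Definition _ := GRing.PzRing.on preproj.

Definition idem (v : vertex Q) : preproj :=
  pa_pi preproj_rel (pbasis k (trivial_path (v : vertex (double_quiver Q)))).
Definition arr (a : arrow Q) : preproj :=
  pa_pi preproj_rel (pbasis k (arrow_path (inl a : arrow (double_quiver Q)))).
Definition arr_star (a : arrow Q) : preproj :=
  pa_pi preproj_rel (pbasis k (arrow_path (inr a : arrow (double_quiver Q)))).

Definition preproj_part (s : nat) : set preproj := graded_part s.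

(* Spelled out because MathComp's [lrmorphism] needs nontrivial algebras, and  *)
(* the path algebra of a quiver without vertices is trivial.                  *)
Definition algebra_automorphism (g : preproj -> preproj) : Prop :=
  [/\ bijective g, linear g & monoid_morphism g].

Definition graded_automorphism (g : preproj -> preproj) : Prop :=
  algebra_automorphism g /\
  forall s, (g @` preproj_part s = preproj_part s)%classic.

Definition finite_order (g : preproj -> preproj) : Prop :=
  exists2 N, (0 < N)%N & forall x, iter N g x = x.

Definition trace_series (g : preproj -> preproj) : fps k :=
  Fps (fun s => trace_on g (preproj_part s)).
Definition vertex_trace_series (v : vertex Q) (g : preproj -> preproj) : fps k :=
  Fps (fun s => trace_on g [set idem v * x | x in preproj_part s]%classic).

End Preprojective.

(* The cyclic quiver of type \tilde A_{n-1}: the ordinal [i : 'I_n] stands    *)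
(* for the vertex e_{i+1} and for the arrow alpha_{i+1} from e_{i+1} to       *)
(* e_{i+2}; [ordS] is the successor modulo [n].                               *)
Definition cyclic_quiver (n : nat) : quiver :=
  @Quiver 'I_n 'I_n id (@ordS n).

Notation preproj_cyclic k n := (preproj k (cyclic_quiver n)).

Definition e_ (k : fieldType) (n : nat) (i : 'I_n) : preproj_cyclic k n :=
  @idem k (cyclic_quiver n) i.
Definition alpha (k : fieldType) (n : nat) (i : 'I_n) : preproj_cyclic k n :=
  @arr k (cyclic_quiver n) i.
Definition alpha_star (k : fieldType) (n : nat) (i : 'I_n) :
    preproj_cyclic k n := @arr_star k (cyclic_quiver n) i.

(* All indices are shifted down by one, from 1..n to 0..n-1.  Since the index *)
(* ranges below are shift invariant modulo n, the formulas keep their shape   *)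
(* for 1-based indices.                                                       *)
Section CyclicFormulas.
Variables (k : fieldType) (n : nat).
Implicit Types c t : 'I_n -> k.

(* The value of [c] at [j] modulo [n] (the default value is unused if n > 0). *)
Definition cyc c (j : nat) : k := oapp c 1 (insub (j %% n)%N).

Definition vector_trace (g : preproj_cyclic k n -> preproj_cyclic k n) :
    'cV[fps k]_n :=
  \col_(i < n) @vertex_trace_series k (cyclic_quiver n) i g.

(* The corner entry M_{n,1} = - c_n t is the case [ordS (n-1) = 0].           *)
Definition step_mx c : 'M[{poly k}]_n :=
  \matrix_(i < n, j < n)
    if j == i then 1 else if j == ordS i then - (c i *: 'X) else 0.

Definition star_col t : 'cV[{poly k}]_n :=
  \col_(l < n) \sum_(0 <= m < n) (\prod_(n - m + l <= j < n + l) cyc t j) *: 'X^m.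

Definition cycle_poly c : {poly k} := 1 - (\prod_(i < n) c i) *: 'X^n.

Definition trace_num c t : {poly k} :=
  \sum_(0 <= v < (2 * n - 2).+1)
    (\sum_(0 <= m < n) \sum_(0 <= s < n | v == (m + s)%N) \sum_(l < n)
       (\prod_(n - m + l <= j < n + l) cyc t j)
       * (\prod_(n - s + l <= r < n + l) cyc c r)) *: 'X^v.

Definition trace_den c t : {poly k} := cycle_poly c * cycle_poly t.

End CyclicFormulas.

(* Main.v *)
Require Import Defs.
From HB Require Import structures.
From mathcomp Require Import all_boot all_order all_algebra.
From mathcomp Require Import zify.
From mathcomp Require Import boolp classical_sets.
From mathcomp.finmap Require Import finmap.
From mathcomp.multinomials Require Import monalg.

Set Implicit Arguments.
Unset Strict Implicit.
Unset Printing Implicit Defensive.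

Import GRing.Theory.
Local Open Scope ring_scope.

(* The relations let every path from a vertex [i] be rewritten as [a] arrows  *)
(* alpha followed by [b] arrows alpha^*; these monomials form a basis of      *)
(* [e_i A]: they are independent because the relations preserve the number of *)
(* arrows of each kind in a path.  They are eigenvectors of [g], so the       *)
(* traces are sums of the eigenvalues.  Splitting off the first alpha gives   *)
(* [Tr_i = S_i + c_i t Tr_(i+1)], where [S_i] collects the monomials without  *)
(* alpha and [(1 - t_1...t_n t^n) S_i] is the polynomial [v_i]; this is (a),  *)
(* and going once around the cycle gives (c).  Indexing the eigenvalues by    *)
(* the vertex [l] where the path turns back gives                             *)
(* [Tr_A = sum_l (S_l for c) (S_l for t)], which is (b).                      *)

(** Spanning is [pi_path], with [partE] and [vertex_partE] giving the graded pieces. Independence is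
    [mon_free]: the functional adding up the coefficients of the paths with a given start and given
    numbers of arrows of each kind vanishes on the ideal ([coord_pi]), hence descends to the algebra
    and is dual to one monomial. The trace does not depend on the basis ([trace_on_basis]), so it is
    the sum of the eigenvalues. The rest is generating functions. Turning once around the cycle
    multiplies an eigenvalue by a fixed product, so the series of pure star monomials is rational
    ([cycle_poly_back_series]). The recursion [vertex_trace_step] then gives (a) and (c), and
    [trace_series_sum] gives (b). For (d), finite order makes every [c i] and [t i] a root of unity
    ([finite_order_scalars]), hence also the roots of the denominator. In characteristic 0 each of
    its two factors has at most a simple zero at 1 ([mup_cycle_poly]), and reducing the fraction
    cannot raise the multiplicity ([pole_order_le]). *)

Section WeightedSum.
Variables (k : fieldType) (Q : quiver) (w : qpath Q -> k).

Definition pa_eval (f : path_alg k Q) : k^o := \sum_(p <- msupp f) f@_p * w p.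

Lemma pa_evalEw (d : {fset qpath Q}) (f : path_alg k Q) :
  (msupp f `<=` d)%fset -> pa_eval f = \sum_(p <- d) f@_p * w p.
Proof.
move=> le; rewrite /pa_eval (big_fset_incl _ le) //.
by move=> p _ /mcoeff_outdom ->; rewrite mul0r.
Qed.

Fact pa_eval_linear : linear pa_eval.
Proof.
move=> c f g; set d := (msupp f `|` msupp g)%fset.
have lef : (msupp f `<=` d)%fset by apply: fsubsetUl.
have leg : (msupp g `<=` d)%fset by apply: fsubsetUr.
have les : (msupp (c *: f + g) `<=` d)%fset.
  apply: fsubset_trans (msuppD_le _ _) _.
  by apply: fsetUSS => //; exact: msuppZ_le.
rewrite (pa_evalEw lef) (pa_evalEw leg) (pa_evalEw les) scaler_sumr -big_split.
by apply: eq_bigr => p _ /=; rewrite mcoeffD mcoeffZ mulrDl -mulrA.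
Qed.
HB.instance Definition _ :=
  GRing.isLinear.Build k (path_alg k Q) k^o _ pa_eval pa_eval_linear.

Lemma pa_eval_pbasis p : pa_eval (pbasis k p) = w p.
Proof.
rewrite (pa_evalEw (msupp_pbasis k p)) big_seq_fset1 mcoeff_pbasis eqxx.
exact: mul1r.
Qed.

Lemma pa_eval_mul3 (f g h : path_alg k Q) :
  pa_eval (f * g * h) =
  \sum_(p <- msupp f) \sum_(q <- msupp h)
     (f@_p * h@_q) *: pa_eval (pbasis k p * g * pbasis k q).
Proof.
rewrite {1}(pbasisE f) {1}(pbasisE h) !mulr_suml linear_sum.
apply: eq_bigr => p _; rewrite mulr_sumr linear_sum; apply: eq_bigr => q _.
rewrite -linearZ; congr pa_eval.
have -> : (f@_p *: pbasis k p) * g = f@_p *: (pbasis k p * g).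
  by rewrite [RHS]pa_scaleAl.
by rewrite -[LHS]pa_scaleAr -[X in _ *: X]pa_scaleAl scalerA mulrC.
Qed.

(** By bilinearity the outer factors of the elements of the ideal may be taken to be paths. *)
Lemma pa_eval_principal_ideal (rho f : path_alg k Q) :
    (forall p q, pa_eval (pbasis k p * rho * pbasis k q) = 0) ->
  f \in principal_ideal rho -> pa_eval f = 0.
Proof.
move=> rho0 /asboolP[s ->]; rewrite linear_sum big1 // => u _ /=.
rewrite pa_eval_mul3 big1 // => p _; rewrite big1 // => q _.
by rewrite rho0 scaler0.
Qed.

End WeightedSum.

HB.instance Definition _ (k : fieldType) (Q : quiver) (rho : path_alg k Q) :=
  GRing.isLinear.Build k (path_alg k Q) (pa_quot rho) *:%R (pa_pi rho)
    (pa_pi_is_linear rho).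

(** * The monomial basis of the preprojective algebra of the cyclic quiver *)

Section Cyclic.
Variables (k : fieldType) (n : nat).
Local Notation Q := (cyclic_quiver n).
Local Notation QQ := (double_quiver Q).
Local Notation A := (preproj_cyclic k n).
Local Notation rho := (preproj_rel k Q).
Local Notation pi := (pa_pi rho).
Implicit Types (i : 'I_n) (p q : qpath QQ).

Definition is_star (x : arrow QQ) : bool := if x is inr _ then true else false.

Definition nb_alpha p := count (predC is_star) (parrows p).
Definition nb_star p := count is_star (parrows p).

Lemma plenE p : plen p = (nb_alpha p + nb_star p)%N.
Proof. by rewrite addnC count_predC. Qed.

(** The type is what the relations preserve; [coord i a b] below will be the functional dual to
    [mon a b i]. *)
Definition has_type i a b p : bool :=
  [&& pstart p == i, nb_alpha p == a & nb_star p == b].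

Local Notation coord i a b :=
  (@pa_eval k QQ (fun p => (has_type i a b p)%:R)).

Fact alpha_loop_walk i :
  walk (i : vertex QQ) ([:: inl i; inr i] : seq (arrow QQ)).
Proof. by rewrite /= !eqxx. Qed.
Definition alpha_loop i : qpath QQ := exist _ (_, _) (alpha_loop_walk i).

Fact star_loop_walk i :
  walk (i : vertex QQ) ([:: inr (ord_pred i); inl (ord_pred i)] : seq (arrow QQ)).
Proof. by rewrite /= ord_predK !eqxx. Qed.
(** The index is [ord_pred i] because the starred arrow leaving [i] is opposite to the arrow
    entering [i]. *)
Definition star_loop i : qpath QQ := exist _ (_, _) (star_loop_walk i).

Lemma alpha_loopE i :
  pbasis k (arrow_path (inl i : arrow QQ)) *
  pbasis k (arrow_path (inr i : arrow QQ)) = pbasis k (alpha_loop i).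
Proof.
rewrite [LHS]pa_mulUU.
have e : pend (arrow_path (inl i : arrow QQ)) =
         pstart (arrow_path (inr i : arrow QQ)) by [].
by rewrite (pcatP e) /=; congr pbasis; apply: qpathP.
Qed.

Lemma star_loopE i :
  pbasis k (arrow_path (inr (ord_pred i) : arrow QQ)) *
  pbasis k (arrow_path (inl (ord_pred i) : arrow QQ)) = pbasis k (star_loop i).
Proof.
rewrite [LHS]pa_mulUU.
have e : pend (arrow_path (inr (ord_pred i) : arrow QQ)) =
         pstart (arrow_path (inl (ord_pred i) : arrow QQ)) by [].
rewrite (pcatP e) /=; congr pbasis; apply: qpathP => //.
by rewrite /pstart /= ord_predK.
Qed.

Lemma preproj_relE :
  rho = \sum_(i < n) (pbasis k (alpha_loop i) - pbasis k (star_loop i)).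
Proof.
rewrite sumrB /preproj_rel; congr (_ - _).
  by apply: eq_bigr => i _; exact: alpha_loopE.
rewrite [LHS](reindex_inj (can_inj (@ord_predK n))) /=.
by apply: eq_bigr => i _; exact: star_loopE.
Qed.

(** Both loops are based at [i] and contain one arrow of each kind, so exchanging them affects
    neither composability nor the type. *)
Lemma coord_loops j a b p q i :
  coord j a b (pbasis k p * pbasis k (alpha_loop i) * pbasis k q) =
  coord j a b (pbasis k p * pbasis k (star_loop i) * pbasis k q).
Proof.
have pend_alpha : pend (alpha_loop i) = i by [].
have pend_star : pend (star_loop i) = i by exact: ord_predK.
have mulE (x : qpath QQ) : pbasis k p * pbasis k x * pbasis k q =
   oapp (@pbasis k QQ) 0 (obind (pcat p) (pcat x q)).
  by rewrite -mulrA [_ * pbasis k q]pa_mulUU [LHS]pa_mulBr.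
rewrite !mulE.
have [e1 | /eqP n1] := eqVneq (i : vertex QQ) (pstart q); last first.
  by rewrite !pcat_none ?pend_alpha ?pend_star.
have ea : pend (alpha_loop i) = pstart q by [].
have es : pend (star_loop i) = pstart q by rewrite pend_star.
rewrite (pcatP ea) (pcatP es) /=.
have [e2 | /eqP n2] := eqVneq (pend p) i; last by rewrite !pcat_none.
set x : qpath QQ := exist _ _ _; set y : qpath QQ := exist _ _ _.
have ex : pend p = pstart x by [].
have ey : pend p = pstart y by [].
rewrite (pcatP ex) (pcatP ey) /= !pa_eval_pbasis.
by rewrite /has_type /nb_alpha /nb_star /parrows /= !count_cat.
Qed.

Lemma coord_pi i a b f g : pi f = pi g -> coord i a b f = coord i a b g.
Proof.
move/pa_pi_eq=> fgI; apply/eqP; rewrite -subr_eq0 -linearB /=; apply/eqP.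
apply: pa_eval_principal_ideal fgI => p q.
rewrite preproj_relE mulr_sumr mulr_suml linear_sum big1 // => j _ /=.
rewrite mulrBr mulrBl linearB /=; apply/eqP; rewrite subr_eq0; apply/eqP.
exact: coord_loops.
Qed.

Local Notation e i := (e_ k i).
Local Notation al i := (alpha k i).
Local Notation als i := (alpha_star k i).

Lemma pi_path_cons (v : 'I_n) (x : arrow QQ) s vs :
  exists w, pbasis k (exist _ (v, x :: s) vs : qpath QQ) =
    pbasis k (arrow_path x) * pbasis k (exist _ (qtgt x, s) w : qpath QQ).
Proof.
have /= /andP[/eqP ev w] := vs; exists w; rewrite [RHS]pa_mulUU.
have e1 : pend (arrow_path x) = pstart (exist _ (qtgt x, s) w : qpath QQ) by [].
by rewrite (pcatP e1) /=; congr pbasis; apply: qpathP; rewrite // /pstart /= ev.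
Qed.

Lemma idem_path i p :
  pbasis k (trivial_path (i : vertex QQ)) * pbasis k p =
  if pstart p == i then pbasis k p else 0.
Proof.
rewrite [LHS]pa_mulUU; case: eqP => [es|ne]; last by rewrite pcat_none // => /esym.
have e1 : pend (trivial_path (i : vertex QQ)) = pstart p by [].
by rewrite (pcatP e1) /=; congr pbasis; apply: qpathP => //; rewrite es.
Qed.

(** The single defining relation is a sum over all vertices; multiplying it on the left by the
    idempotent at [i] isolates the relation at [i]. *)
Lemma alpha_commute i :
  al i * als i = als (ord_pred i) * al (ord_pred i).
Proof.
apply/eqP; rewrite -subr_eq0; apply/eqP.
have <- : pi (pbasis k (trivial_path (i : vertex QQ)) * rho) = 0.
  rewrite -(linear0 pi); apply/pa_pi_eq; rewrite subr0.
  by apply/asboolP; exists [:: (pbasis k (trivial_path (i : vertex QQ)), 1)];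
    rewrite big_seq1 mulr1.
have -> : pbasis k (trivial_path (i : vertex QQ)) * rho =
    pbasis k (alpha_loop i) - pbasis k (star_loop i).
  rewrite preproj_relE mulr_sumr (bigD1 i) //= big1 ?addr0 => [|j ne_ji].
    by rewrite mulrBr !idem_path /pstart /= eqxx.
  by rewrite mulrBr !idem_path /pstart /= (negPf ne_ji) subr0.
by rewrite -alpha_loopE -star_loopE linearB /= !pa_piM.
Qed.

Fixpoint star_mon b i : A :=
  if b is b'.+1 then als (ord_pred i) * star_mon b' (ord_pred i) else e i.

(* [mon a b i] is the class of the path from [i] with [a] arrows alpha, then   *)
(* [b] arrows alpha^*.                                                         *)
Fixpoint mon a b i : A :=
  if a is a'.+1 then al i * mon a' b (ordS i) else star_mon b i.

(** Repeated use of [alpha_commute] moves the leading star to the right past all the alphas. *)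
Lemma alpha_star_mon a b i :
  als (ord_pred i) * mon a b (ord_pred i) = mon a b.+1 i.
Proof.
elim: a i => [//|a IHa] i /=.
by rewrite ord_predK mulrA -alpha_commute -mulrA -IHa ordSK.
Qed.

Lemma pi_path p : pi (pbasis k p) = mon (nb_alpha p) (nb_star p) (pstart p).
Proof.
case: p => -[v s] vs; rewrite /nb_alpha /nb_star /parrows /pstart /=.
elim: s v vs => [|x s IHs] v vs /=.
  by congr pi; congr pbasis; apply: qpathP.
have [w ->] := pi_path_cons vs; rewrite pa_piM IHs.
case: x vs w => [x|x] /= /andP[/eqP <- _] w; rewrite ?add0n ?add1n //=.
by rewrite -alpha_star_mon ordSK.
Qed.

(** Exactly one arrow of each kind leaves every vertex, so no type is empty. *)
Lemma mon_path a b i :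
  exists2 p, has_type i a b p & mon a b i = pi (pbasis k p).
Proof.
suff [p t] : exists p, has_type i a b p.
  by exists p => //; case/and3P: t => /eqP <- /eqP <- /eqP <-; rewrite pi_path.
elim: a b i => [|a IHa] b i.
  elim: b i => [|b IHb] i.
    by exists (trivial_path (i : vertex QQ)); rewrite /has_type eqxx.
  have [p /and3P[/eqP sp /eqP ap /eqP bp]] := IHb (ord_pred i).
  have e1 : pend (arrow_path (inr (ord_pred i) : arrow QQ)) = pstart p by [].
  exists (exist _ (_, _) (pcat_walk e1)).
  rewrite /has_type /nb_alpha /nb_star /parrows /pstart /= ord_predK eqxx.
  by rewrite -/(parrows p) -/(nb_alpha p) -/(nb_star p) ap bp !eqxx.
have [p /and3P[/eqP sp /eqP ap /eqP bp]] := IHa b (ordS i).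
have e1 : pend (arrow_path (inl i : arrow QQ)) = pstart p by [].
exists (exist _ (_, _) (pcat_walk e1)).
rewrite /has_type /nb_alpha /nb_star /parrows /pstart /= eqxx.
by rewrite -/(parrows p) -/(nb_alpha p) -/(nb_star p) ap bp !eqxx.
Qed.

Lemma coord_mon a b i a' b' i' f : mon a b i = pi f ->
  coord i' a' b' f = ((i == i') && (a == a') && (b == b'))%:R.
Proof.
have [p t ->] := mon_path a b i; move=> /(coord_pi i' a' b') <-.
rewrite pa_eval_pbasis /has_type.
by case/and3P: t => /eqP -> /eqP -> /eqP ->; rewrite andbA.
Qed.

(** Applying the dual functional of one monomial to the relation isolates its coefficient. The
    family has an arbitrary finite index type so as to serve both for one vertex and for a whole
    graded part. *)
Lemma mon_free (T : finType) (a b : T -> nat) (i : T -> 'I_n) (z : T -> k) :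
  injective (fun x => (a x, b x, i x)) ->
  \sum_x z x *: mon (a x) (b x) (i x) = 0 -> forall x, z x = 0.
Proof.
move=> inj_abi z0 x.
have mE y : exists f, mon (a y) (b y) (i y) = pi f.
  by have [p _ ->] := mon_path (a y) (b y) (i y); exists (pbasis k p).
have {mE} [f fE] := choice mE.
have : coord (i x) (a x) (b x) (\sum_y z y *: f y) =
       coord (i x) (a x) (b x) 0.
  apply: coord_pi; rewrite linear0 -z0 linear_sum; apply: eq_bigr => y _.
  by rewrite linearZ /= fE.
rewrite linear0 linear_sum (bigD1 x) //= big1 => [|y ne_yx].
  by rewrite linearZ /= (coord_mon _ _ _ (fE x)) !eqxx addr0 [_ *: _]mulr1.
rewrite linearZ /= (coord_mon _ _ _ (fE y)).
case: eqP => [e1|]; last by rewrite scaler0.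
case: eqP => [e2|]; last by rewrite scaler0.
case: eqP => [e3|]; last by rewrite scaler0.
by case/eqP: ne_yx; apply: inj_abi; rewrite e1 e2 e3.
Qed.

End Cyclic.

(** * Basis independence of the trace, and traces of diagonal maps *)

Section Trace.
Variables (k : fieldType) (V : lmodType k).
Implicit Types (U : set V).

Lemma lin_combP d (b : 'I_d -> V) m (M : 'M[k]_(m, d)) (v : 'rV[k]_m) :
  \sum_(i < m) v 0 i *: lin_comb b (row i M) = lin_comb b (v *m M).
Proof.
rewrite /lin_comb; under eq_bigr do rewrite scaler_sumr.
rewrite exchange_big; apply: eq_bigr => j _; rewrite mxE scaler_suml.
by apply: eq_bigr => i _; rewrite mxE scalerA.
Qed.

Lemma lin_comb_delta d (b : 'I_d -> V) i : lin_comb b (delta_mx 0 i) = b i.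
Proof.
rewrite /lin_comb (bigD1 i) //= big1 => [|j ne_ji].
  by rewrite mxE !eqxx scale1r addr0.
by rewrite mxE (negPf ne_ji) andbF scale0r.
Qed.

Lemma basis_change U d d' (b : 'I_d -> V) (b' : 'I_d' -> V) :
    is_basis_of U b -> is_basis_of U b' ->
  exists P : 'M[k]_(d', d), forall i, b' i = lin_comb b (row i P).
Proof.
move=> [_ Ub] [_ Ub'].
have : forall i, exists v, b' i = lin_comb b v.
  move=> i; have : U (b' i) by rewrite -Ub' -lin_comb_delta; exists (delta_mx 0 i).
  by rewrite -Ub => -[v _ <-]; exists v.
move/choice => [h hE]; exists (\matrix_(i, j) h i 0 j) => i.
by rewrite hE; congr lin_comb; apply/rowP => j; rewrite !mxE.
Qed.

(** The sizes [d] and [d'] are not assumed equal; using it in both directions gives two inverse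
    rectangular matrices. *)
Lemma basis_changeK U d d' (b : 'I_d -> V) (b' : 'I_d' -> V)
    (P : 'M[k]_(d', d)) (P' : 'M[k]_(d, d')) :
    is_basis_of U b -> (forall i, b' i = lin_comb b (row i P)) ->
  (forall i, b i = lin_comb b' (row i P')) -> P' *m P = 1%:M.
Proof.
move=> [injb _] b'E bE; apply/row_matrixP => i; apply: injb.
rewrite row_mul row1 lin_comb_delta bE -lin_combP.
by apply: eq_bigr => j _; rewrite b'E.
Qed.

(** Two matrices of [f] satisfy [M' *m P = P *m M], so cyclicity of the trace gives
    [\tr M' = \tr (P *m M *m P') = \tr M]. *)
Lemma trace_on_basis U (f : V -> V) d (b : 'I_d -> V) (M : 'M[k]_d) :
    linear f -> is_basis_of U b ->
    (forall i, f (b i) = lin_comb b (row i M)) ->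
  trace_on f U = \tr M.
Proof.
move=> linf Ub fb; rewrite /trace_on; apply: xget_unique; first by exists d, b, M.
move=> _ [d' [b' [M' [Ub' fb' ->]]]].
have [P b'E] := basis_change Ub Ub'; have [P' bE] := basis_change Ub' Ub.
have PP' := basis_changeK Ub' bE b'E; have P'P := basis_changeK Ub b'E bE.
have f_comb (v : 'rV_d) : f (lin_comb b v) = lin_comb b (v *m M).
  pose F := GRing.isLinear.Build k V V *:%R f linf.
  pose Lf : {linear V -> V} := HB.pack f F.
  rewrite -lin_combP -[LHS]/(Lf _) /lin_comb linear_sum; apply: eq_bigr => i _.
  by rewrite linearZ /= fb.
have M'E : M' *m P = P *m M.
  apply/row_matrixP => i; have [injb _] := Ub; apply: injb.
  rewrite !row_mul -f_comb -b'E fb' -lin_combP.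
  by apply: eq_bigr => j _; rewrite b'E.
by rewrite -[M']mulmx1 -PP' mulmxA M'E mxtrace_mulC mulmxA P'P mul1mx.
Qed.

Lemma iter_eigen (f : V -> V) N d x :
  linear f -> f x = d *: x -> iter N f x = d ^+ N *: x.
Proof.
move=> linf fx; elim: N => [|N IHN]; first by rewrite scale1r.
have f0 : f 0 = 0 by have := linf (-1) 0 0; rewrite scaler0 addr0 scaleN1r addNr.
by rewrite iterS IHN -[X in f X]addr0 linf fx f0 addr0 scalerA exprSr.
Qed.

Definition span_of (T : finType) (b : T -> V) : set V :=
  [set u | exists z : T -> k, u = \sum_x z x *: b x]%classic.

Lemma span_of_basis (T : finType) (b : T -> V) x : span_of b (b x).
Proof.
exists (fun y => (y == x)%:R); rewrite (bigD1 x) //= big1 ?addr0 ?eqxx ?scale1r //.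
by move=> y /negPf ->; rewrite scale0r.
Qed.

Lemma span_of_sum (T : finType) (b : T -> V) (I : eqType) (r : seq I)
    (z : I -> k) (F : I -> V) :
    (forall i, i \in r -> span_of b (F i)) ->
  span_of b (\sum_(i <- r) z i *: F i).
Proof.
move=> bF; rewrite big_seq; elim/big_ind: _ => [|_ _ [y ->] [y' ->]|i /bF[y ->]].
- by exists (fun=> 0); rewrite big1 // => x _; rewrite scale0r.
- by exists (fun x => y x + y' x); rewrite -big_split; apply: eq_bigr => x _;
    rewrite scalerDl.
- by exists (fun x => z i * y x); rewrite scaler_sumr; apply: eq_bigr => x _;
    rewrite scalerA.
Qed.

Lemma trace_on_diag (T : finType) (b : T -> V) (w : T -> k) (f : V -> V) :
    linear f -> (forall x, f (b x) = w x *: b x) ->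
    (forall z : T -> k, \sum_x z x *: b x = 0 -> forall x, z x = 0) ->
  trace_on f (span_of b) = \sum_x w x.
Proof.
move=> linf fb freeb; pose b' (i : 'I_#|T|) := b (enum_val i).
have combE (v : 'rV_#|T|) : lin_comb b' v = \sum_x v 0 (enum_rank x) *: b x.
  rewrite (reindex (@enum_val T T)) /=; last exact: onW_bij (@enum_val_bij T).
  by apply: eq_bigr => i _; rewrite enum_valK.
rewrite (@trace_on_basis _ _ _ b' (diag_mx (\row_i w (enum_val i)))) //.
- rewrite mxtrace_diag (reindex (@enum_val T T)) /=.
    by apply: eq_bigr => i _; rewrite mxE.
  exact: onW_bij (@enum_val_bij T).
- split=> [v v' eq_v|].
    apply/rowP => i; apply/eqP; rewrite -subr_eq0; apply/eqP.
    have := freeb (fun x => v 0 (enum_rank x) - v' 0 (enum_rank x)).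
    move/(_ _ (enum_val i)); rewrite enum_valK; apply.
    under eq_bigr do rewrite scalerBl.
    by rewrite sumrB -!combE eq_v subrr.
  apply/seteqP; split=> u /=.
    by case=> v _ <-; exists (fun x => v 0 (enum_rank x)); rewrite combE.
  case=> z ->; exists (\row_i z (enum_val i)) => //; rewrite combE.
  by apply: eq_bigr => x _; rewrite mxE enum_rankK.
move=> i; rewrite fb /lin_comb (bigD1 i) //= big1 ?addr0 => [|j /negPf ne_ji].
  by rewrite !mxE eqxx mulr1n.
by rewrite !mxE eq_sym ne_ji mulr0n scale0r.
Qed.

End Trace.

(** * Graded pieces and the eigenvalues of the automorphism *)

Section CyclicTrace.
Variables (k : fieldType) (n : nat).
Local Notation Q := (cyclic_quiver n).
Local Notation QQ := (double_quiver Q).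
Local Notation A := (preproj_cyclic k n).
Local Notation rho := (preproj_rel k Q).
Local Notation pi := (pa_pi rho).
Local Notation mon := (@mon k n).
Local Notation e i := (e_ k i).
Local Notation part := (@preproj_part k Q).

Lemma part_sum s (T : finType) (z : T -> k) (F : T -> A) :
  (forall x, part s (F x)) -> part s (\sum_x z x *: F x).
Proof.
move=> sF; elim/big_ind: _ => [|_ _ [f sf <-] [g sg <-]|x _].
- by exists 0; rewrite ?(linear0 pi) // => p; rewrite msupp0.
- exists (f + g); rewrite ?pa_piD // => p.
  by move/(fsubsetP (msuppD_le _ _)); rewrite inE => /orP[/sf|/sg].
have [f sf <-] := sF x; exists (z x *: f); rewrite ?pa_piZ // => p.
by move/(fsubsetP (msuppZ_le _ _))/sf.
Qed.

Lemma mon_part s a i : (a < s.+1)%N -> part s (mon a (s - a) i).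
Proof.
rewrite ltnS => le_as; set b := (s - a)%N.
have -> : s = (a + b)%N by rewrite subnKC.
have [p /and3P[_ /eqP ap /eqP bp] ->] := @mon_path k n a b i.
exists (pbasis k p) => // q /(fsubsetP (msupp_pbasis k p)).
by move/fset1P->; rewrite plenE ap bp.
Qed.

Lemma idem_mon a b i j : e i * mon a b j = if j == i then mon a b j else 0.
Proof.
have [p /and3P[/eqP sp _ _] ->] := @mon_path k n a b j.
rewrite -[LHS]pa_piM idem_path sp.
by case: ifP => // _; exact: (linear0 pi).
Qed.

Lemma part_pi s u : part s u -> exists2 f : path_alg k QQ,
  (forall p, p \in msupp f -> plen p = s) &
  u = \sum_(p <- msupp f) f@_p *: mon (nb_alpha p) (s - nb_alpha p) (pstart p).
Proof.
case=> f /= sf <-; exists f => //.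
rewrite {1}(pbasisE f) [LHS](linear_sum pi); apply: eq_big_seq => p /sf <-.
by rewrite [LHS]pa_piZ pi_path plenE addKn.
Qed.

Lemma nb_alpha_lt s (p : qpath QQ) : plen p = s -> (nb_alpha p < s.+1)%N.
Proof. by rewrite plenE => <-; rewrite ltnS leq_addr. Qed.

(** Left multiplication by the idempotent kills the monomials starting at other vertices; in degree
    [s] those left are determined by their number [a <= s] of alphas. *)
Lemma vertex_partE s i :
  [set e i * x | x in part s]%classic =
  span_of (fun a : 'I_s.+1 => mon a (s - a) i).
Proof.
apply/seteqP; split=> u /=.
  case=> x /part_pi[f sf ->] <-; rewrite mulr_sumr.
  under eq_bigr do rewrite -[_ * _]paq_scaleAr.
  apply: span_of_sum => p /sf/nb_alpha_lt lt_p; rewrite idem_mon.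
  case: eqP => [-> | _].
    exact: (span_of_basis (fun a : 'I_s.+1 => mon a (s - a) i) (Ordinal lt_p)).
  by exists (fun=> 0); rewrite big1 // => a _; rewrite scale0r.
case=> z ->; exists (\sum_(a < s.+1) z a *: mon a (s - a) i).
  apply: (part_sum z) => a; exact: mon_part.
rewrite mulr_sumr; apply: eq_bigr => a _.
by rewrite -[LHS]paq_scaleAr idem_mon eqxx.
Qed.

Lemma partE s :
  part s = span_of (fun x : 'I_n * 'I_s.+1 => mon x.2 (s - x.2) x.1).
Proof.
apply/seteqP; split=> u /=.
  case/part_pi=> f sf ->; apply: span_of_sum => p /sf/nb_alpha_lt lt_p.
  exact: (span_of_basis (fun x : 'I_n * 'I_s.+1 => mon x.2 (s - x.2) x.1)
           (pstart p : 'I_n, Ordinal lt_p)).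
case=> z ->; apply: (part_sum z) => x; exact: mon_part.
Qed.

(* [back_prod f b i] is f_(i-1) f_(i-2) ... f_(i-b), indices modulo [n].       *)
Fixpoint back_prod (f : 'I_n -> k) b i : k :=
  if b is b'.+1 then f (ord_pred i) * back_prod f b' (ord_pred i) else 1.

Section Automorphism.
Variables (g : A -> A) (c t : 'I_n -> k).
Hypothesis g_lin : linear g.
Hypothesis gM : {morph g : x y / x * y}.
Hypothesis g_e : forall i, g (e i) = e i.
Hypothesis g_alpha : forall i, g (alpha k i) = c i *: alpha k i.
Hypothesis g_alpha_star : forall i, g (alpha_star k i) = t i *: alpha_star k i.

(** The eigenvalue of [g] on [mon a b i], by the same recursion as [mon]. *)
Fixpoint mon_weight a b i : k :=
  if a is a'.+1 then c i * mon_weight a' b (ordS i) else back_prod t b i.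

Lemma paq_scaleM (d d' : k) (x y : A) : (d *: x) * (d' *: y) = (d * d') *: (x * y).
Proof.
by rewrite -scalerA [d' *: (x * y)]paq_scaleAr [RHS]paq_scaleAl.
Qed.

Lemma g_mon a b i : g (mon a b i) = mon_weight a b i *: mon a b i.
Proof.
elim: a i => [|a IHa] i /=; last by rewrite gM g_alpha IHa paq_scaleM.
elim: b i => [|b IHb] i /=; first by rewrite g_e scale1r.
by rewrite gM g_alpha_star IHb paq_scaleM.
Qed.

Lemma vertex_trace_coef i s :
  fps_coef (vertex_trace_series (Q := Q) i g) s =
  \sum_(a < s.+1) mon_weight a (s - a) i.
Proof.
rewrite /= -/(e i) vertex_partE; apply: trace_on_diag => // [a|z].
  exact: g_mon.
apply: (@mon_free k n 'I_s.+1 val (fun a => s - a)%N (fun=> i)).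
by move=> a a' [/val_inj ->].
Qed.

Lemma trace_coef s :
  fps_coef (trace_series g) s =
  \sum_(i < n) \sum_(a < s.+1) mon_weight a (s - a) i.
Proof.
rewrite pair_bigA /= partE; apply: trace_on_diag => // [x|z].
  exact: g_mon.
apply: (@mon_free k n ('I_n * 'I_s.+1)%type (fun x => val x.2)
  (fun x => s - x.2)%N fst).
by move=> [i a] [i' a'] /= [/val_inj -> _ ->].
Qed.

(** The arrows are themselves nonzero eigenvectors, so their eigenvalues have the same finite
    order. *)
Lemma finite_order_scalars : finite_order g ->
  exists2 N, (0 < N)%N & forall i, c i ^+ N = 1 /\ t i ^+ N = 1.
Proof.
case=> N N_gt0 gN; exists N => // i.
(* A monomial is nonzero: freeness of a one-element family. *)
have inj_mon a b j d : d *: mon a b j = mon a b j -> d = 1.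
  move=> dE; apply/eqP; rewrite -subr_eq0; apply/eqP.
  apply: (@mon_free k n unit (fun=> a) (fun=> b) (fun=> j) (fun=> d - 1) _ _ tt).
    by case=> -[].
  by rewrite big_const card_unit /= addr0 scalerBl scale1r dE subrr.
have weightX a b j : mon_weight a b j ^+ N = 1.
  by apply: (inj_mon a b j); rewrite -(iter_eigen _ g_lin (g_mon a b j)) gN.
(* The star opposite to arrow [i] starts at [ordS i]. *)
have := weightX 1%N 0%N i; have := weightX 0%N 1%N (ordS i).
by rewrite /= ordSK !mulr1.
Qed.

End Automorphism.
End CyclicTrace.

(** * Polynomials inside power series, and invertible series *)

Section Fps.
Variable k : fieldType.
Implicit Types (f h : fps k) (p q : {poly k}).
Local Notation P := (@fps_of_poly k).

Fact fps_of_poly_zmod_morphism : zmod_morphism P.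
Proof. by move=> p q; apply: fpsP => s /=; rewrite coefB. Qed.
HB.instance Definition _ :=
  GRing.isZmodMorphism.Build {poly k} (fps k) P fps_of_poly_zmod_morphism.

Fact fps_of_poly_monoid_morphism : monoid_morphism P.
Proof. by split=> // p q; apply: fpsP => s /=; rewrite coefM. Qed.
HB.instance Definition _ :=
  GRing.isMonoidMorphism.Build {poly k} (fps k) P fps_of_poly_monoid_morphism.

Definition fps_coef0 f : k := fps_coef f 0.

Fact fps_coef0_zmod_morphism : zmod_morphism fps_coef0.
Proof. by []. Qed.
HB.instance Definition _ :=
  GRing.isZmodMorphism.Build (fps k) k fps_coef0 fps_coef0_zmod_morphism.

Fact fps_coef0_monoid_morphism : monoid_morphism fps_coef0.
Proof.
by split=> [|f h]; rewrite /fps_coef0 /= ?coef1 // big_ord1.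
Qed.
HB.instance Definition _ :=
  GRing.isMonoidMorphism.Build (fps k) k fps_coef0 fps_coef0_monoid_morphism.

Lemma coef_polyMf p f s :
  fps_coef (P p * f) s = \sum_(i < s.+1) p`_i * fps_coef f (s - i).
Proof. by []. Qed.

Lemma coef_ZXnMf d m f s :
  fps_coef (P (d *: 'X^m) * f) s = if (s < m)%N then 0 else d * fps_coef f (s - m).
Proof.
rewrite coef_polyMf; case: ltnP => [lt_sm | le_ms].
  rewrite big1 // => i _; rewrite coefZ coefXn.
  by rewrite ltn_eqF ?mulr0 ?mul0r // (leq_ltn_trans _ lt_sm) // -ltnS.
rewrite (bigD1 (Ordinal (le_ms : m < s.+1)%N)) //= big1 => [|i].
  by rewrite coefZ coefXn eqxx mulr1 addr0.
by rewrite -val_eqE /= => /negPf ne; rewrite coefZ coefXn ne mulr0 mul0r.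
Qed.

Lemma fps_unitE f : (f \is a GRing.unit) = (fps_coef0 f != 0).
Proof.
apply/idP/idP => [uf | f0].
  by rewrite -unitfE; apply: (rmorph_unit fps_coef0).
(* [inv_pre m] lists the first [m] coefficients of the inverse, computed by  *)
(* the usual recursion; the last summand only matters for the coefficient 0. *)
pose inv_pre := fix inv_pre m : seq k :=
  if m is m'.+1 then
    let r := inv_pre m' in
    rcons r (- (fps_coef0 f)^-1 *
      \sum_(i < m') r`_i * fps_coef f (m' - i) + (m' == 0)%:R / fps_coef0 f)
  else [::].
have size_pre m : size (inv_pre m) = m.
  by elim: m => //= m IHm; rewrite size_rcons IHm.
have nth_pre m i : (i < m)%N -> (inv_pre m)`_i = (inv_pre i.+1)`_i.
  elim: m => // m IHm; rewrite ltnS leq_eqVlt => /predU1P[-> //|lt_im].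
  by rewrite [inv_pre m.+1]/= nth_rcons size_pre lt_im IHm.
pose h : fps k := Fps (fun m => (inv_pre m.+1)`_m).
apply/asboolP; exists h; apply: fpsP => s /=; rewrite big_ord_recr /= subnn.
rewrite nth_rcons size_pre ltnn eqxx coef1 mulrDl -/(fps_coef0 f).
rewrite mulrAC mulrVK ?unitfE // mulNr mulVf // mulN1r addrA.
under eq_bigr => i _ do rewrite -[X in X * _]/((inv_pre i.+1)`_i) -(@nth_pre s) //.
by rewrite addrN add0r.
Qed.

End Fps.

(** * Products around the cycle and their generating series *)

Section CyclicProducts.
Variables (k : fieldType) (n : nat).
Hypothesis n_gt0 : (0 < n)%N.
Implicit Types (f c t : 'I_n -> k) (l i : 'I_n).
Local Notation P := (@fps_of_poly k).

(** The bound [m <= n] keeps the natural-number subtraction from truncating. *)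
Lemma val_iter_ord_pred m l :
  (m <= n)%N -> val (iter m (@ord_pred n) l) = ((n - m + l) %% n)%N.
Proof.
elim: m => [|m IHm] lt_mn /=; first by rewrite subn0 modnDl modn_small.
rewrite IHm ?(ltnW lt_mn) // -addn1.
have -> : ((n - m + l) %% n + n).-1 = ((n - m + l) %% n + n.-1)%N by lia.
rewrite modnDml.
have -> : (n - m + l + n.-1 = n - (m + 1) + l + n)%N by lia.
by rewrite modnDr.
Qed.

Lemma iter_ord_pred_n l : iter n (@ord_pred n) l = l.
Proof. by apply: val_inj; rewrite val_iter_ord_pred // subnn add0n modn_small. Qed.

Lemma iter_ordS_pred m l : iter m (@ordS n) (iter m (@ord_pred n) l) = l.
Proof. by elim: m => // m IHm; rewrite iterSr (iterS m (@ord_pred n)) ord_predK IHm. Qed.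

Lemma iter_ordS_n l : iter n (@ordS n) l = l.
Proof. by rewrite -{1}(iter_ord_pred_n l) iter_ordS_pred. Qed.

Lemma back_prodE f m l :
  back_prod f m l = \prod_(j < m) f (iter j.+1 (@ord_pred n) l).
Proof.
elim: m l => [|m IHm] l; first by rewrite big_ord0.
rewrite big_ord_recl /= IHm; congr (_ * _).
by apply: eq_bigr => j _; rewrite -iterSr.
Qed.

Lemma back_prodD f a b l :
  back_prod f (a + b) l = back_prod f a l * back_prod f b (iter a (@ord_pred n) l).
Proof.
by elim: a l => [|a IHa] l /=; rewrite ?mul1r // IHa -mulrA -iterSr.
Qed.

Lemma back_prodSr f m l :
  back_prod f m.+1 l = f (iter m.+1 (@ord_pred n) l) * back_prod f m l.
Proof. by have := back_prodD f m 1 l; rewrite addn1 => ->; rewrite /= mulr1 mulrC. Qed.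

(** The first [n] iterated predecessors of [l] run through every vertex once: two of the exponents
    differ by less than [n], so their residues are distinct. *)
Lemma back_prod_n f l : back_prod f n l = \prod_i f i.
Proof.
rewrite back_prodE.
have inj : injective (fun j : 'I_n => iter j.+1 (@ord_pred n) l).
  move=> i j /(congr1 val); rewrite !val_iter_ord_pred // => eq_ij.
  apply/val_inj => /=; move/eqP: eq_ij.
  have := ltn_ord i; have := ltn_ord j => lt_j lt_i.
  have [le|/ltnW le] := leqP i j.
    have -> : (n - i.+1 + l = (n - j.+1 + l) + (j - i))%N by lia.
    rewrite -[X in _ == X %[mod _]]addn0 eqn_modDl mod0n modn_small; last by lia.
    by move/eqP; lia.
  have -> : (n - j.+1 + l = (n - i.+1 + l) + (i - j))%N by lia.
  rewrite -[X in X == _ %[mod _]]addn0 eqn_modDl mod0n modn_small; last by lia.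
  by move/eqP; lia.
by rewrite [RHS](reindex_inj inj).
Qed.

Lemma back_prodDn f m l :
  back_prod f (n + m) l = (\prod_i f i) * back_prod f m l.
Proof. by rewrite back_prodD back_prod_n iter_ord_pred_n. Qed.

Lemma cyc_val f j i : val i = (j %% n)%N -> cyc f j = f i.
Proof.
move=> ij; rewrite /cyc; case: insubP => [u _ uj|]; last by rewrite ltn_mod n_gt0.
by congr f; apply: val_inj; rewrite uj ij.
Qed.

Lemma prod_cyc f m l : (m <= n)%N ->
  \prod_(n - m + l <= j < n + l) cyc f j = back_prod f m l.
Proof.
elim: m => [|m IHm] lt_mn; first by rewrite subn0 big_geq.
rewrite big_ltn; last by lia.
have -> : (n - m.+1 + l).+1 = (n - m + l)%N by lia.
rewrite IHm ?(ltnW lt_mn) // back_prodSr; congr (_ * _).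
by apply: cyc_val; rewrite val_iter_ord_pred.
Qed.

(** For [t] this is the trace on the pure star monomials starting at [l]; for [c], on the pure alpha
    monomials ending at [l]. *)
Definition back_series f l : fps k := Fps (fun m => back_prod f m l).

Lemma star_colE f l :
  star_col f l 0 = \sum_(m < n) back_prod f m l *: 'X^m.
Proof.
rewrite mxE big_mkord; apply: eq_bigr => m _; congr (_ *: _).
by rewrite prod_cyc // ltnW.
Qed.

Lemma cycle_polyMf f (h : fps k) s :
  fps_coef (P (cycle_poly f) * h) s = fps_coef h s -
    (if (s < n)%N then 0 else (\prod_i f i) * fps_coef h (s - n)).
Proof. by rewrite rmorphB rmorph1 mulrBl mul1r /= -coef_ZXnMf. Qed.

(** By [back_prodDn] the coefficients are periodic up to the factor [\prod_i f i], so all terms of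
    degree at least [n] cancel. *)
Lemma cycle_poly_back_series f l :
  P (cycle_poly f) * back_series f l = P (star_col f l 0).
Proof.
apply: fpsP => s; rewrite cycle_polyMf star_colE /= coef_sum.
case: ltnP => [lt_sn | le_ns].
  rewrite (bigD1 (Ordinal lt_sn)) //= big1 => [|m].
    by rewrite coefZ coefXn eqxx mulr1 subr0 addr0.
  rewrite -val_eqE /= eq_sym => /negPf ne.
  by rewrite coefZ coefXn ne mulr0.
rewrite -{1}(subnKC le_ns) back_prodDn subrr big1 // => m _.
by rewrite coefZ coefXn gtn_eqF ?mulr0 // (leq_trans _ le_ns).
Qed.

Lemma cycle_poly_coef0 f : (cycle_poly f)`_0 = 1.
Proof. by rewrite coefB coef1 eqxx coefZ coefXn ltn_eqF // mulr0 subr0. Qed.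

Lemma cycle_poly_neq0 f : cycle_poly f != 0.
Proof.
apply/eqP => /(congr1 (fun p : {poly k} => p`_0)) /=.
by rewrite cycle_poly_coef0 coef0 => /eqP; rewrite oner_eq0.
Qed.

Lemma trace_den_coef0 c t : (trace_den c t)`_0 = 1 :> k.
Proof. by rewrite coef0M !cycle_poly_coef0 mulr1. Qed.

Lemma trace_den_unit c t : P (trace_den c t) \is a GRing.unit.
Proof. by rewrite fps_unitE /fps_coef0 /= trace_den_coef0 oner_eq0. Qed.

Lemma trace_numE (c t : 'I_n -> k) :
  trace_num c t = \sum_l star_col c l 0 * star_col t l 0.
Proof.
pose F (m s : nat) (l : 'I_n) :=
  (\prod_(n - m + l <= j < n + l) cyc t j) *
  (\prod_(n - s + l <= r < n + l) cyc c r).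
have -> : \sum_l star_col c l 0 * star_col t l 0 =
    \sum_(m < n) \sum_(s < n) (\sum_(l < n) F m s l) *: 'X^(m + s).
  under [RHS]eq_bigr do under eq_bigr do rewrite scaler_suml.
  under [RHS]eq_bigr do rewrite exchange_big.
  rewrite [RHS]exchange_big; apply: eq_bigr => l _; rewrite !mxE !big_mkord.
  rewrite mulrC mulr_suml; apply: eq_bigr => m _; rewrite mulr_sumr.
  apply: eq_bigr => s _.
  by rewrite -scalerAl -scalerAr scalerA exprD.
rewrite /trace_num big_mkord.
under eq_bigr do rewrite big_mkord scaler_suml.
rewrite exchange_big; apply: eq_bigr => m _.
under eq_bigr do rewrite big_mkord scaler_suml big_mkcond.
rewrite exchange_big; apply: eq_bigr => s _.
(* Each pair [(m, s)] contributes to exactly one degree [v], which lies in the summation range. *)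
have lt_ms : (m + s < (2 * n - 2).+1)%N by have := ltn_ord m; have := ltn_ord s; lia.
rewrite (bigD1 (Ordinal lt_ms)) //= eqxx [X in _ + X]big1 ?addr0 // => v.
by rewrite -val_eqE /= => /negPf ->.
Qed.

End CyclicProducts.

(** * Pole orders at 1 and roots of the denominator *)

Section PoleOrder.
Variable k : fieldType.
Local Notation P := (@fps_of_poly k).

Lemma mup_le_dvdp (a : k) (p q : {poly k}) :
  q != 0 -> p %| q -> (mup a p <= mup a q)%N.
Proof.
move=> q0 pq; have p0 : p != 0 by apply: contraNneq q0 => p0; rewrite p0 dvd0p in pq.
by rewrite mup_geq // (dvdp_trans _ pq) // -mup_geq.
Qed.

(** The gcd of [p] and [q] divides [q], so its constant term is nonzero; it is invertible as a power
    series and can be cancelled to reach the reduced fraction. *)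
Lemma pole_order_le (f : fps k) (p q : {poly k}) (a : k) :
  q`_0 != 0 -> P q * f = P p -> exists2 m, pole_order f a m & (m <= mup a q)%N.
Proof.
move=> q00 qf; have q0 : q != 0 by apply: contraNneq q00 => ->; rewrite coef0.
set d := gcdp p q.
have dp : d %| p by apply: dvdp_gcdl.
have dq : d %| q by apply: dvdp_gcdr.
have q'0 : q %/ d != 0 by apply: contraNneq q0 => q'0; rewrite -(divpK dq) q'0 mul0r.
exists (mup a (q %/ d)); last first.
  by apply: mup_le_dvdp => //; rewrite -{2}(divpK dq) dvdp_mulIl.
exists (p %/ d), (q %/ d); split=> //.
  by rewrite coprimep_div_gcd // q0 orbT.
have uPd : P d \is a GRing.unit.
  rewrite fps_unitE; apply: contraNneq q00; rewrite /fps_coef0 /= => d0.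
  by rewrite -(divpK dq) coef0M d0 mulr0.
apply: (mulrI uPd); rewrite mulrA -!rmorphM /=.
by rewrite ![d * _]mulrC !divpK.
Qed.

Lemma horner_cycle_poly n (c : 'I_n -> k) x :
  (cycle_poly c).[x] = 1 - (\prod_i c i) * x ^+ n.
Proof. by rewrite /cycle_poly !hornerE. Qed.

(** If 1 were a double root, vanishing at 1 would force [C = 1], and the derivative at 1 would be
    [- n], nonzero in characteristic 0. *)
Lemma mup_cycle_poly n (c : 'I_n -> k) :
  [pchar k] =i pred0 -> (0 < n)%N -> (mup 1 (cycle_poly c) <= 1)%N.
Proof.
move=> char0 n_gt0; set q := cycle_poly c; set C := \prod_i c i.
have q0 : q != 0 by apply: cycle_poly_neq0.
rewrite mup_leq //; apply/negP => /dvdpP[h qE].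
have r1 : root q 1 by rewrite qE rootM root_exp_XsubC eqxx orbT.
have r2 : root q^`() 1.
  have : ('X - 1%:P).[1] = 0 :> k by rewrite hornerXsubC subrr.
  rewrite qE expr2 !derivM derivXsubC; move: ('X - 1%:P) => e e1.
  by rewrite rootE hornerD !hornerM hornerD !hornerM e1 !(mulr0, mul0r, addr0).
move: r1; rewrite rootE horner_cycle_poly -/C expr1n mulr1 subr_eq0.
move=> /eqP C1; move: r2; rewrite /q /cycle_poly -/C -C1 scale1r.
rewrite rootE derivB derivC derivXn sub0r hornerN hornerMn hornerXn expr1n oppr_eq0.
by move/pcharf0P: char0 => ->; rewrite eqn0Ngt n_gt0.
Qed.

Lemma mup_trace_den n (c t : 'I_n -> k) :
  [pchar k] =i pred0 -> (0 < n)%N -> (mup 1 (trace_den c t) <= 2)%N.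
Proof.
move=> char0 n_gt0.
have nz f : @cycle_poly k n f != 0 by apply: cycle_poly_neq0.
by rewrite mupM // (leq_add (mup_cycle_poly c _ _) (mup_cycle_poly t _ _)).
Qed.

Lemma root_cycle_poly n (c : 'I_n -> k) N x :
    (forall i, c i ^+ N = 1) -> root (cycle_poly c) x ->
  (n * N).-unity_root x.
Proof.
move=> cN; rewrite rootE horner_cycle_poly subr_eq0 => /eqP Cx.
rewrite unity_rootE exprM.
have : (\prod_i c i) ^+ N = 1.
  by rewrite -prodrXl big1.
by move=> CN; rewrite -[X in X == _]mul1r -{1}CN -exprMn -Cx expr1n.
Qed.
End PoleOrder.

(** * The rational formulas for the trace series *)

(** Taking constant terms turns the matrix into the identity, so its determinant has constant term
    1. *)
Lemma step_mx_unit (k : fieldType) n (c : 'I_n -> k) :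
  map_mx (@fps_of_poly k) (step_mx c) \in unitmx.
Proof.
rewrite unitmxE fps_unitE -det_map_mx.
have -> : map_mx (@fps_coef0 k) (map_mx (@fps_of_poly k) (step_mx c)) = 1%:M.
  apply/matrixP => i j; rewrite !mxE /fps_coef0 /= eq_sym.
  case: eqP => _; first by rewrite coef1.
  by case: eqP => _; rewrite ?coefN ?coefZ ?coefX ?mulr0 ?oppr0 ?coef0.
by rewrite det1 oner_eq0.
Qed.

Section TraceSeries.
Variables (k : fieldType) (n : nat).
Hypothesis n_gt1 : (1 < n)%N.
Let n_gt0 : (0 < n)%N := ltnW n_gt1.
Local Notation P := (@fps_of_poly k).
Local Notation A := (preproj_cyclic k n).
Variables (g : A -> A) (c t : 'I_n -> k).
Hypothesis g_lin : linear g.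
Hypothesis gM : {morph g : x y / x * y}.
Hypothesis g_e : forall i, g (e_ k i) = e_ k i.
Hypothesis g_alpha : forall i, g (alpha k i) = c i *: alpha k i.
Hypothesis g_alpha_star : forall i, g (alpha_star k i) = t i *: alpha_star k i.
Local Notation T i := (@vertex_trace_series k (cyclic_quiver n) i g).

(** Needed so that the two nonzero entries in a row of [step_mx] occupy different columns. *)
Lemma ordS_neq (i : 'I_n) : ordS i != i.
Proof.
apply/eqP => /(congr1 val) /=; have := ltn_ord i => lt_i.
have [e|ne] := eqVneq (i.+1) n; first by rewrite e modnn; lia.
by rewrite modn_small; lia.
Qed.

(** The summand [a = 0] is the pure star monomial; every other monomial begins with the alpha at
    [i], followed by a monomial starting at [ordS i]. *)
Lemma vertex_trace_step i :
  T i = back_series t i + P (c i *: 'X^1) * T (ordS i).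
Proof.
apply: fpsP => s.
rewrite [LHS](vertex_trace_coef g_lin gM g_e g_alpha g_alpha_star).
rewrite big_ord_recl subn0 [RHS]/(_ + _) [LHS]/=; congr (_ + _).
rewrite -[RHS]/(fps_coef (P _ * _) s) coef_ZXnMf.
case: s => [|s] /=; first by rewrite big_ord0.
rewrite [X in _ = _ * X](vertex_trace_coef g_lin gM g_e g_alpha g_alpha_star).
rewrite subn1 mulr_sumr; apply: eq_bigr => a _.
by rewrite /= /bump /= add1n subSS.
Qed.

Lemma step_mx_trace :
  P (cycle_poly t) *: vector_trace g =
  invmx (map_mx P (step_mx c)) *m map_mx P (star_col t).
Proof.
apply: (canRL (mulKmx (step_mx_unit c))); apply/colP => i.
rewrite [RHS]mxE -cycle_poly_back_series // mxE.
rewrite (bigD1 i) //= (bigD1 (ordS i)) ?ordS_neq //= big1 => [|j /andP[n1 n2]].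
  rewrite !mxE eqxx (negPf (ordS_neq i)) eqxx addr0 rmorph1 mul1r rmorphN.
  rewrite [X in _ * X + _]vertex_trace_step expr1 mulrDr mulNr.
  by rewrite (mulrCA (P (c i *: 'X))) addrK.
by rewrite !mxE (negPf n1) (negPf n2) rmorph0 mul0r.
Qed.

(** Seen from the turning vertex [iter a (@ordS n) i], both the alphas and the stars run through the
    preceding vertices. *)
Lemma mon_weightE a b i :
  mon_weight c t a b i =
  back_prod c a (iter a (@ordS n) i) * back_prod t b (iter a (@ordS n) i).
Proof.
elim: a i => [|a IHa] i; first by rewrite mul1r.
rewrite [LHS]/= IHa -iterSr mulrA; congr (_ * _).
have iterK m (j : 'I_n) : iter m (@ord_pred n) (iter m (@ordS n) j) = j.
  by elim: m => // m IHm; rewrite iterSr iterS ordSK IHm.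
by rewrite back_prodSr iterK.
Qed.

(** For fixed [a], start and turning vertex determine each other; reindexing by the latter leaves
    the coefficients of a Cauchy product. *)
Lemma trace_series_sum : trace_series g = \sum_l back_series c l * back_series t l.
Proof.
have coef_sum (F : 'I_n -> fps k) s :
    fps_coef (\sum_l F l) s = \sum_l fps_coef (F l) s.
  by apply: (big_morph (fun f : fps k => fps_coef f s)).
apply: fpsP => s; rewrite coef_sum /=.
rewrite [LHS](trace_coef g_lin gM g_e g_alpha g_alpha_star).
rewrite exchange_big [RHS]exchange_big; apply: eq_bigr => a _.
have inj : injective (iter a (@ordS n)).
  by elim: (nat_of_ord a) => // m IHm x y /ordS_inj /IHm.
rewrite [RHS](reindex_inj inj); apply: eq_bigr => i _.
by rewrite mon_weightE.
Qed.

Lemma trace_series_den :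
  P (trace_den c t) * trace_series g = P (trace_num c t).
Proof.
rewrite trace_series_sum trace_numE // mulr_sumr rmorph_sum; apply: eq_bigr => l _.
by rewrite !rmorphM mulrACA !cycle_poly_back_series.
Qed.

Lemma vertex_trace_den i :
  exists p, P (trace_den c t) * T i = P p.
Proof.
(* Unrolling the recursion [m] times keeps a polynomial remainder. For [m = n] the vertex is [i]
   again, and moving the last term to the left produces the factor [cycle_poly c]. *)
have step m : exists p, P (cycle_poly t) * T i = P p +
    P ((\prod_(j < m) c (iter j (@ordS n) i)) *: 'X^m) *
    (P (cycle_poly t) * T (iter m (@ordS n) i)).
  elim: m => [|m [p ->]].
    by exists 0; rewrite rmorph0 big_ord0 scale1r rmorph1 mul1r add0r.
  set d := \prod_(j < m) _; set l := iter m _ i.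
  exists (p + (d *: 'X^m) * star_col t l 0).
  rewrite [T l]vertex_trace_step mulrDr cycle_poly_back_series // mulrDr.
  rewrite (rmorphD _ p) (rmorphM _ (d *: 'X^m)) addrA; congr (_ + _).
  rewrite big_ord_recr /= -/d -/l (mulrCA (P (cycle_poly t))) [LHS]mulrA; congr (_ * _).
  rewrite -[LHS]rmorphM; congr P.
  by rewrite -scalerAl -scalerAr scalerA -exprD addn1.
have [p] := step n; rewrite iter_ordS_n //.
(* Going forward from [i] lists the vertices in the reverse of the order used by [back_prod_n]. *)
have -> : \prod_(j < n) c (iter j (@ordS n) i) = \prod_i c i.
  have := back_prod_n n_gt0 c i.
  rewrite back_prodE => <-; rewrite (reindex_inj rev_ord_inj) /=.
  apply: eq_bigr => j _; congr c.
  have {1}-> : i = iter (n - j.+1 + j.+1) (@ord_pred n) i.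
    by rewrite subnK // iter_ord_pred_n.
  by rewrite iterD iter_ordS_pred.
move=> E; exists p; rewrite rmorphM -mulrA rmorphB rmorph1 mulrBl mul1r {1}E.
by rewrite addrK.
Qed.

End TraceSeries.

Theorem mainTheorem3 (k : closedFieldType) (char0 : [pchar k] =i pred0)
    (n : nat) (n_ge3 : (3 <= n)%N)
    (g : preproj_cyclic k n -> preproj_cyclic k n)
    (g_aut : graded_automorphism g)
    (g_e : forall i : 'I_n, g (e_ k i) = e_ k i)
    (c t : 'I_n -> k)
    (g_alpha : forall i : 'I_n, g (alpha k i) = c i *: alpha k i)
    (g_alpha_star : forall i : 'I_n,
       g (alpha_star k i) = t i *: alpha_star k i) :
  [/\ (* (a) *)
      (let M := map_mx (@fps_of_poly k) (step_mx c) in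
       let v := map_mx (@fps_of_poly k) (star_col t) in
       M \in unitmx /\
       fps_of_poly (cycle_poly t) *: vector_trace g = invmx M *m v),
      (* (b) *)
      (fps_of_poly (trace_den c t) \is a GRing.unit /\
       trace_series g =
         fps_of_poly (trace_num c t) / fps_of_poly (trace_den c t)),
      (* (c) *)
      (forall i : 'I_n, exists p : {poly k},
         vertex_trace_series (Q := cyclic_quiver n) i g =
           fps_of_poly p / fps_of_poly (trace_den c t))
    & (* (d) *)
      [/\ finite_order g ->
            forall x : k, root (trace_den c t) x ->
              exists2 m, (0 < m)%N & m.-unity_root x,
          exists2 m, pole_order (trace_series g) 1 m & (m <= 2)%N
        & forall i : 'I_n,
            exists2 m, pole_order
                (vertex_trace_series (Q := cyclic_quiver n) i g) 1 m
              & (m <= 2)%N]].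
Proof.
have n_gt1 : (1 < n)%N by apply: leq_trans n_ge3.
have n_gt0 : (0 < n)%N by apply: ltnW.
have [[_ g_lin [_ gM]] _] := g_aut.
have den0 : (trace_den c t)`_0 != 0 by rewrite trace_den_coef0 // oner_eq0.
have den_unit := trace_den_unit n_gt0 c t.
have trA := trace_series_den n_gt1 g_lin gM g_e g_alpha g_alpha_star.
have trV i := vertex_trace_den n_gt1 g_lin gM g_e g_alpha g_alpha_star i.
(* The bound depends only on the common denominator, so it serves the full trace and every vertex
   trace. *)
have pole f p : fps_of_poly (trace_den c t) * f = fps_of_poly p ->
    exists2 m, pole_order f 1 m & (m <= 2)%N.
  move=> fE; have [m fm le_m] := pole_order_le 1 den0 fE.
  by exists m => //; apply: leq_trans le_m (mup_trace_den c t char0 n_gt0).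
split.
- split; first exact: step_mx_unit.
  exact: (step_mx_trace n_gt1 g_lin gM g_e g_alpha g_alpha_star).
- by split=> //; rewrite -trA mulrC mulKr.
- by move=> i; have [p trp] := trV i; exists p; rewrite -trp mulrC mulKr.
split.
- case/(finite_order_scalars g_lin gM g_e g_alpha g_alpha_star) => N N_gt0 ctN x.
  have nN_gt0 : (0 < n * N)%N by rewrite muln_gt0 n_gt0.
  by rewrite rootM => /orP[] rx; exists (n * N)%N => //;
    apply: root_cycle_poly rx => i; case: (ctN i).
- exact: pole trA.
- by move=> i; have [p trp] := trV i; exact: pole trp.
Qed.
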